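(* For any lattice $\mathcal{L} \subset \mathbb{R}^n$ and sublattices $\mathcal{M},\mathcal{N} \subseteq \mathcal{L}$, \[ \frac{\rho(\mathcal{M})}{\rho(\mathcal{L})} \cdot \frac{\rho(\mathcal{N})}{\rho(\mathcal{L})} \leq \frac{\rho(\mathcal{M} \cap \mathcal{N})}{\rho(\mathcal{L})} . \]
   Context: A lattice $\mathcal{L}\subset\mathbb{R}^n$ is the set of all integer linear combinations of $n$ linearly independent vectors of $\mathbb{R}^n$. A sublattice of $\mathcal{L}$ is an additive subgroup of $\mathcal{L}$ (not necessarily of full rank $n$). For $\mathbf{x}\in\mathbb{R}^n$, $\rho(\mathbf{x}) = \exp(-\pi \|\mathbf{x}\|^2)$ with $\|\cdot\|$ the Euclidean norm, and for a discrete set $A\subset\mathbb{R}^n$, $\rho(A) = \sum_{\mathbf{w}\in A}\rho(\mathbf{w})$. *)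

(* Defs.v *)
From HB Require Import structures.
From mathcomp Require Export all_boot all_order all_algebra.
From mathcomp Require Export all_classical all_reals all_analysis.

Set Implicit Arguments.
Unset Strict Implicit.
Unset Printing Implicit Defensive.

Import Order.TTheory GRing.Theory Num.Theory.
Local Open Scope classical_set_scope.
Local Open Scope ring_scope.

(* [L] is the set of integer combinations of the rows of [B], which are [n]
   linearly independent vectors of R^n. *)
Definition is_lattice (R : realType) (n : nat) (L : set 'rV[R]_n) : Prop :=
  exists2 B : 'M[R]_n, row_free B &
    L = [set x | exists z : 'I_n -> int, x = \sum_(i < n) row i B *~ z i].

Definition is_sublattice (R : realType) (n : nat) (M L : set 'rV[R]_n) : Prop :=
  M `<=` L /\ zmod_closed [in M].

(* The library norm [`|x|] on ['rV[R]_n] is the sup norm, hence this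
   definition. *)
Definition euclidean_norm (R : realType) (n : nat) (x : 'rV[R]_n) : R :=
  Num.sqrt (\sum_(i < n) x 0 i ^+ 2).

Definition rho (R : realType) (n : nat) (x : 'rV[R]_n) : R :=
  expR (- (pi * euclidean_norm x ^+ 2)).

(* Extended-real valued, so that the sum of nonnegative terms makes sense for
   every set; it is finite and positive on lattices. *)
Definition rho_set (R : realType) (n : nat) (A : set 'rV[R]_n) : \bar R :=
  \esum_(w in A) (rho w)%:E.

(* Main.v *)
(* Put [K := M :&: N], [S := M + N], and [h := expR (- pi |x|^2 / 2)], so that
   the parallelogram law reads [h (x + y) * h (x - y) = rho x * rho y].  With
   the 2K-periodic function [F u := \sum_(k in K) h (u + 2k)] it gives
     rho(K) rho(S) = \sum_(u in S) h(u) F(u) = \sum_(c in S/2K) F(c)^2.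
   In [rho(M) rho(N) = \sum_(m in M, n in N) h(m + n) h(m - n)], the class of
   [m - n] modulo 2K only depends on that of [m + n], and [m + n |-> m - n]
   induces an involution [t] of S/2K, hence
     rho(M) rho(N) = \sum_(c in S/2K) F(c) F(t c) <= \sum_(c in S/2K) F(c)^2
   by Cauchy-Schwarz, and [rho(S) <= rho(L)]. *)
Require Import Defs.
From mathcomp Require Import all_boot all_order all_algebra.
From mathcomp Require Import all_classical all_reals all_analysis.
From mathcomp Require Import ring lra.
Import Order.TTheory GRing.Theory Num.Theory.

Local Open Scope classical_set_scope.
Local Open Scope ring_scope.
Local Open Scope ereal_scope.

Lemma esumZl (R : realType) (T : choiceType) (I : set T) (r : R)
    (a : T -> \bar R) :
  (0 <= r)%R -> (forall i, 0 <= a i) ->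
  \esum_(i in I) (r%:E * a i) = r%:E * \esum_(i in I) a i.
Proof.
move=> r0 a0; rewrite /esum -ereal_supZl//; last first.
  by apply/set0P; exists 0; exists set0; [exact: fsets_set0|rewrite fsbig_set0].
congr ereal_sup; rewrite image_comp; apply: eq_imagel => A _ /=.
by rewrite ge0_mule_fsumr.
Qed.

(** Nonnegative terms may be summed one variable at a time; finiteness of the sum over [J] lets it
    act as a real scalar in [esumZl]. *)
Lemma esumM (R : realType) (T1 T2 : choiceType) (I : set T1) (J : set T2)
    (a : T1 -> R) (b : T2 -> R) :
  (forall i, 0 <= a i)%R -> (forall j, 0 <= b j)%R ->
  \esum_(j in J) (b j)%:E < +oo ->
  (\esum_(i in I) (a i)%:E) * (\esum_(j in J) (b j)%:E) =
  \esum_(p in I `*` J) (a p.1 * b p.2)%:E.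
Proof.
move=> a0 b0 bfin.
rewrite -(@esum_esum _ _ _ I (fun=> J)
  (fun i j => (a i * b j)%:E)); last first.
  by move=> i j _ _; rewrite lee_fin mulr_ge0.
have bE : \esum_(j in J) (b j)%:E = (fine (\esum_(j in J) (b j)%:E))%:E.
  by rewrite fineK// ge0_fin_numE// esum_ge0// => j _; rewrite lee_fin.
rewrite muleC bE -esumZl//; last first.
  by apply: fine_ge0; apply: esum_ge0 => j _; rewrite lee_fin.
apply: eq_esum => i _; rewrite -bE muleC.
by rewrite -esumZl// => *; rewrite lee_fin.
Qed.

Lemma le_esum_set (R : realType) (T : choiceType) (I J : set T)
    (a : T -> \bar R) :
  (forall i, 0 <= a i) -> I `<=` J -> \esum_(i in I) a i <= \esum_(i in J) a i.
Proof.
move=> a0 IJ; rewrite (esumID I J)// (setIidr IJ) leeDl// esum_ge0//.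
Qed.

Lemma le_term_esum (R : realType) (T : choiceType) (I : set T)
    (a : T -> \bar R) i :
  (forall i, 0 <= a i) -> I i -> a i <= \esum_(i in I) a i.
Proof.
move=> a0 Ii; rewrite -[leLHS](@esum_set1 _ _ i a)//.
by apply: le_esum_set => // j ->.
Qed.

(* The quotient S/2K is avoided: Cauchy-Schwarz is replaced by the weighted
   bound [2 <= F u / F v + F v / F u] with [u = m + n] and [v = m - n], whose two
   terms have the same sum over M x N by the symmetry [n |-> - n].  Summing the
   first one over the fibres of [u], which are cosets of K, eliminates [F v]. *)
Lemma esum_gaussian_mul_le (R : realType) (V : zmodType) (M N : set V)
    (g h : V -> R) :
  zmod_closed [in M] -> zmod_closed [in N] ->
  (forall x, 0 < g x)%R -> (forall x, 0 < h x)%R ->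
  (forall x y, h (x + y) * h (x - y) = g x * g y)%R ->
  let S := [set (p.1 + p.2)%R | p in M `*` N] in
  \esum_(x in S) (g x)%:E < +oo ->
  (\esum_(x in M) (g x)%:E) * (\esum_(x in N) (g x)%:E) <=
  (\esum_(x in M `&` N) (g x)%:E) * (\esum_(x in S) (g x)%:E).
Proof.
move=> [M0 MB] [N0 NB] g0 h0 hg S Sfin.
have {}M0 : M 0%R by rewrite inE in M0.
have {}N0 : N 0%R by rewrite inE in N0.
move: MB NB => MB' NB'.
have MB x y : M x -> M y -> M (x - y)%R.
  by move=> Mx My; have := MB' x y; rewrite !inE; apply.
have NB x y : N x -> N y -> N (x - y)%R.
  by move=> Nx Ny; have := NB' x y; rewrite !inE; apply.
have MD x y : M x -> M y -> M (x + y)%R.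
  by move=> Mx My; rewrite -[y]opprK; apply: (MB) => //; rewrite -sub0r; exact: MB.
have ND x y : N x -> N y -> N (x + y)%R.
  by move=> Nx Ny; rewrite -[y]opprK; apply: (NB) => //; rewrite -sub0r; exact: NB.
set K := M `&` N.
have KB x y : K x -> K y -> K (x - y)%R.
  by move=> [? ?] [? ?]; split; [exact: MB|exact: NB].
have KD x y : K x -> K y -> K (x + y)%R.
  by move=> [? ?] [? ?]; split; [exact: MD|exact: ND].
have ge0 x : 0 <= (g x)%:E by rewrite lee_fin ltW.
have he0 x : 0 <= (h x)%:E by rewrite lee_fin ltW.
have MS : M `<=` S by move=> m Mm; exists (m, 0%R) => //=; rewrite addr0.
have NS : N `<=` S by move=> m Mm; exists (0%R, m) => //=; rewrite add0r.
have fin_sub A : A `<=` S -> \esum_(x in A) (g x)%:E < +oo.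
  by move=> AS; apply: le_lt_trans Sfin; apply: le_esum_set.
have KS : K `<=` S by move=> x [/MS].
pose F x := \esum_(k in K) (h (x + k + k))%:E.
have F0 x : 0 <= F x by apply: esum_ge0.
(* [hg] at [u + k] and [k] gives h(u) h(u + 2k) = g(k) g(u + k), and (u, k) |-> (k, u + k) maps [S]
   x [K] bijectively onto [K] x [S]. *)
have XE : \esum_(u in S) ((h u)%:E * F u) =
    (\esum_(x in K) (g x)%:E) * (\esum_(x in S) (g x)%:E).
  under eq_esum => u Su.
    rewrite /F -esumZl//; last exact: ltW.
    under eq_esum => k _.
      rewrite -EFinM (_ : h u * h _ = g k * g (u + k))%R; last first.
        by rewrite [RHS]mulrC -hg addrK mulrC.
      over.
    over.
  rewrite esum_esum//; last by move=> *; rewrite lee_fin mulr_ge0// ltW.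
  rewrite esumM//; try (by move=> x; exact: ltW).
  have SKD u k : S u -> K k -> S (u + k)%R.
    move=> [[m n] [/= Mm Nn] <-] [Mk Nk].
    by exists (m + k, n)%R; [split => //; exact: MD|rewrite /= addrAC].
  have SKB u k : S u -> K k -> S (u - k)%R.
    move=> [[m n] [/= Mm Nn] <-] [Mk Nk].
    by exists (m - k, n)%R; [split => //; exact: MB|rewrite /= addrAC].
  rewrite (reindex_esum (S `*`` (fun=> K)) (K `*` S)
    (fun p => (p.2, p.1 + p.2)%R))//; split => //=.
  - by move=> [u k] [/= Su Kk]; split => //=; exact: SKD.
  - by move=> [u k] [u' k'] _ _ /= [-> /addIr ->].
  - move=> [k u] [/= Kk Su]; exists (u - k, k)%R => /=; last by rewrite subrK.
    by split => //=; exact: SKB.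
have Kfin := fin_sub _ KS.
have Xfin : \esum_(u in S) ((h u)%:E * F u) < +oo.
  rewrite XE lte_mul_pinfty//; first exact: esum_ge0.
  by rewrite ge0_fin_numE ?esum_ge0.
(* h(u) F(u) is one term of a finite sum, and h(u) > 0. *)
have Ffin u : S u -> F u < +oo.
  move=> Su; have : (h u)%:E * F u < +oo.
    apply: le_lt_trans Xfin.
    apply: (@le_term_esum _ _ S (fun u => (h u)%:E * F u)) => // x.
    by rewrite mule_ge0.
  by have := F0 u; case: (F u) => [r||]//= _; rewrite ?ltry// gt0_muley// lte_fin.
have K0 : K 0%R by split.
have Fgt0 u : 0 < F u.
  apply: (@lt_le_trans _ _ (h u)%:E); first by rewrite lte_fin.
  rewrite -[u in leLHS]addr0 -[u in leLHS]addr0.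
  rewrite [leLHS](_ : _ = (h (u + 0 + 0))%:E)//.
  exact: (@le_term_esum _ _ K (fun k => (h (u + k + k))%:E)).
(* A real-valued version of [F], so that ratios can be formed; it agrees with [F] on [S], where [F]
   is finite. *)
pose f u := fine (F u).
have FE u : S u -> F u = (f u)%:E by move=> Su; rewrite fineK// ge0_fin_numE// Ffin.
have f0 u : S u -> (0 < f u)%R by move=> Su; rewrite fine_gt0// Fgt0 Ffin.
have Fper u k : K k -> F (u + k + k)%R = F u.
  move=> Kk; rewrite /F [RHS](reindex_esum K K (fun x => x + k)%R).
    apply: eq_esum => x _; congr (h _)%:E.
    by rewrite (addrC x k) !addrA (addrAC (u + k)%R k x).
  split => //=.
  - by move=> x Kx; exact: KD.
  - by move=> x y _ _ /addIr.
  - by move=> x Kx; exists (x - k)%R; [exact: KB|rewrite subrK].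
rewrite esumM ?fin_sub//; try (by move=> x; exact: ltW).
set T := (X in X <= _).
pose w (p : V * V) :=
  (h (p.1 + p.2) * h (p.1 - p.2) * (f (p.1 + p.2) / f (p.1 - p.2)))%R.
have SB m n : M m -> N n -> S (m - n)%R.
  by move=> Mm Nn; exists (m, - n)%R => //; split => //=; rewrite -sub0r; exact: NB.
have SD m n : M m -> N n -> S (m + n)%R by move=> Mm Nn; exists (m, n)%R.
have w0 p : (0 <= w p)%R.
  by rewrite /w !mulr_ge0 ?invr_ge0 ?fine_ge0// ltW.
pose X := \esum_(p in M `*` N) (w p)%:E.
(* n |-> -n exchanges m + n and m - n, so the sum weighted by the inverse ratio F(m - n) / F(m + n)
   is [X] as well. *)
have X'E : \esum_(p in M `*` N) (w (p.1, - p.2)%R)%:E = X.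
  rewrite /X [RHS](reindex_esum (M `*` N) (M `*` N)
    (fun p => (p.1, - p.2)%R))//.
  have NN n : N n -> N (- n)%R by move=> Nn; rewrite -sub0r; exact: NB.
  split => //=.
  - by move=> [m n] [/= Mm Nn]; split => //=; exact: NN.
  - by move=> [m n] [m' n'] _ _ /= [-> /oppr_inj ->].
  - move=> [m n] [/= Mm Nn].
    by exists (m, - n)%R => /=; [split => //=; exact: NN|rewrite opprK].
(* Termwise: 2 <= a / b + b / a, that is (a - b)^2 / (a b) >= 0, multiplied by h(m + n) h(m - n) =
   g(m) g(n). *)
have TX : T + T <= X + X.
  rewrite -{2}X'E /T /X -!esumD; try by move=> *; rewrite lee_fin ?w0 ?mulr_ge0 ?(ltW (g0 _)).
  apply: le_esum => -[m n] [/= Mm Nn]; rewrite -!EFinD lee_fin /w /= opprK -hg.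
  have := f0 _ (SB _ _ Mm Nn); have := f0 _ (SD _ _ Mm Nn).
  set a := f _; set b := f _ => a0 b0.
  set c := h _; set d := h _.
  have cd0 : (0 <= c * d)%R by apply: mulr_ge0; apply: ltW; exact: h0.
  have : (2 <= a / b + b / a)%R.
    rewrite -subr_ge0 (_ : _ - _ = (a - b) ^+ 2 / (a * b))%R; last first.
      by field; rewrite !gt_eqF.
    by rewrite divr_ge0 ?sqr_ge0// mulr_ge0// ltW.
  by move=> /(ler_wpM2l cd0); lra.
(* Fix one decomposition u = m(u) + n(u); the others are (m(u) + k, n(u) - k) with k in [K]. Their
   differences are v + 2k, where [F] takes the constant value F(v), and h(v + 2k) sums over k to
   F(v), which cancels the denominator. *)
have XX : X = \esum_(u in S) ((h u)%:E * F u).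
  have decompose u : {p | S u -> [/\ M p.1, N p.2 & p.1 + p.2 = u]%R}.
    apply: cid; case: (pselect (S u)) => [[p [Mp Np] pu]|nS]; first by exists p.
    (* An arbitrary default for [u] outside [S], where nothing is claimed. *)
    by exists (0, 0)%R.
  pose m u := (sval (decompose u)).1; pose n u := (sval (decompose u)).2.
  have mn u : S u -> [/\ M (m u), N (n u) & m u + n u = u]%R by exact: (svalP (decompose u)).
  have sumk (x y z : V) : ((x + z) + (y - z) = x + y)%R.
    by rewrite addrACA subrr addr0.
  rewrite /X (reindex_esum (S `*`` (fun=> K)) (M `*` N)
     (fun p => (m p.1 + p.2, n p.1 - p.2)%R)); last first.
    split => //=.
    - move=> [u k] [/= Su [Mk Nk]]; have [? ? _] := mn _ Su.
      by split => /=; [exact: MD|exact: NB].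
    - move=> [u k] [u' k']; rewrite !inE /= => -[/= Su _] [/= Su' _] [e1 e2].
      have [_ _ Eu] := mn _ Su; have [_ _ Eu'] := mn _ Su'.
      have uu' : u = u'.
        by rewrite -Eu -Eu' -(sumk (m u) (n u) k) e1 e2 sumk.
      by subst u'; move/addrI: e1 => ->.
    - move=> [x y] [/= Mx Ny]; have Sxy := SD _ _ Mx Ny.
      have [Mm Nn E] := mn _ Sxy.
      (* The shift x - m(x + y) lies in [M]; it equals n(x + y) - y, hence lies in [N] too. *)
      exists (x + y, x - m (x + y))%R => /=.
        split => //=; split; first exact: MB.
        have -> : (x - m (x + y) = n (x + y) - y)%R.
          by apply/eqP; rewrite subr_eq addrAC eq_sym subr_eq eq_sym addrC E.
        exact: NB.
      congr pair; first by rewrite addrC subrK.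
      by rewrite opprB addrA [(n _ + _)%R]addrC E addrC addKr.
  rewrite -(@esum_esum _ _ _ S (fun=> K)
    (fun u k => (w (m u + k, n u - k)%R)%:E)); last first.
    by move=> *; rewrite lee_fin.
  apply: eq_esum => u Su; have [Mm Nn E] := mn _ Su.
  set v := (m u - n u)%R; have Sv : S v by exact: SB.
  under eq_esum => k Kk.
    rewrite /w /= sumk E opprB.
    rewrite (_ : m u + k + (k - n u) = v + k + k)%R; last first.
      by rewrite addrA (addrAC (m u + k)%R) (addrAC (m u)).
    rewrite {2}/f Fper// -/(f v).
    rewrite (_ : _ * _ * _ = (h u * f u / f v) * h (v + k + k))%R; last first.
      by ring.
    rewrite EFinM; over.
  rewrite esumZl//; last by rewrite !mulr_ge0 ?invr_ge0 ?fine_ge0// ltW.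
  rewrite -/(F v) !FE// -!EFinM divfK//.
  by rewrite gt_eqF// f0.
(* It remains to see T <= X: from X < T, doubling would contradict [TX]. *)
rewrite -XE -XX leNgt; apply/negP => XT.
have Xfn : X \is a fin_num by rewrite ge0_fin_numE ?XX// esum_ge0// => u _; rewrite mule_ge0.
by have := le_lt_trans TX (lteD XT XT); rewrite ltxx.
Qed.

Lemma lattice_addr (R : realType) (n : nat) (L : set 'rV[R]_n) (x y : 'rV[R]_n) :
  is_lattice L -> L x -> L y -> L (x + y)%R.
Proof.
move=> [B _ ->] [z ->] [t ->]; exists (fun i => z i + t i)%R.
by rewrite -big_split; apply: eq_bigr => i _; rewrite mulrzDr.
Qed.

Lemma sqr_euclidean_norm (R : realType) (n : nat) (x : 'rV[R]_n) :
  (euclidean_norm x ^+ 2 = \sum_(i < n) x 0 i ^+ 2)%R.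
Proof. by rewrite sqr_sqrtr// sumr_ge0// => i _; rewrite sqr_ge0. Qed.

Lemma parallelogram_law (R : realType) (n : nat) (x y : 'rV[R]_n) :
  (euclidean_norm (x + y) ^+ 2 + euclidean_norm (x - y) ^+ 2 =
   2 * (euclidean_norm x ^+ 2 + euclidean_norm y ^+ 2))%R.
Proof.
rewrite !sqr_euclidean_norm -!big_split mulr_sumr; apply: eq_bigr => i _ /=.
by rewrite !mxE; ring.
Qed.

Theorem theorem5p1 (R : realType) (n : nat) (L M N : set 'rV[R]_n) :
  is_lattice L -> is_sublattice M L -> is_sublattice N L ->
  (rho_set M / rho_set L) * (rho_set N / rho_set L)
    <= rho_set (M `&` N) / rho_set L.
Proof.
move=> latL [ML Mz] [NL Nz].
have rho_gt0 x : (0 < rho x :> R)%R by exact: expR_gt0.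
have rho_ge0 (x : 'rV[R]_n) : 0 <= (rho x)%:E by rewrite lee_fin ltW.
have rho_set_ge0 (A : set 'rV[R]_n) : 0 <= rho_set A by exact: esum_ge0.
(* Convergence of the Gaussian sum need not be shown: were it infinite, its inverse would be 0 and
   both sides would vanish. *)
have [Loo|Lfin] := eqVneq (rho_set L) +oo.
  by rewrite Loo invey !mule0.
have L0 : L 0%R by apply: ML; have := Mz.1; rewrite inE.
have Lgt0 : 0 < rho_set L.
  apply: (@lt_le_trans _ _ (rho (0 : 'rV[R]_n)%R)%:E); first by rewrite lte_fin.
  exact: (@le_term_esum _ _ L (fun x => (rho x)%:E)).
have Llty : rho_set L < +oo by rewrite ltey.
set S := [set (p.1 + p.2)%R | p in M `*` N].
have SL : S `<=` L.
  by move=> _ [[x y] [/= /ML Lx /NL Ly] <-]; exact: lattice_addr.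
have Slty : rho_set S < +oo.
  by apply: le_lt_trans Llty; exact: le_esum_set.
pose h (x : 'rV[R]_n) := expR (- (pi * euclidean_norm x ^+ 2 / 2)) : R.
(* The claim with denominators cleared, first with M + N in place of [L], then enlarged by
   monotonicity. *)
have main : rho_set M * rho_set N <= rho_set (M `&` N) * rho_set L.
  apply: (@le_trans _ _ (rho_set (M `&` N) * rho_set S)).
    apply: (@esum_gaussian_mul_le _ _ M N (@rho R n) h) => //.
      by move=> x; exact: expR_gt0.
    move=> x y; rewrite /rho /h -!expRD; congr expR.
    by rewrite -!opprD -mulrDl -!mulrDr parallelogram_law; field.
  by rewrite lee_wpmul2l//; exact: le_esum_set.
(* All masses involved are real numbers, so the final division is carried out in [R]. *)
have fin A : A `<=` L -> exists2 a, (0 <= a)%R & rho_set A = a%:E.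
  move=> AL; exists (fine (rho_set A)); first exact: fine_ge0.
  rewrite fineK// ge0_fin_numE//; apply: le_lt_trans Llty.
  exact: le_esum_set.
have [l l0 lE] := fin _ (fun x => id).
have [a a0 aE] := fin _ ML.
have [b b0 bE] := fin _ NL.
have [c c0 cE] := fin (M `&` N) (fun x '(conj Mx _) => ML _ Mx).
move: main Lgt0; rewrite lE aE bE cE lte_fin -!EFinM lee_fin => main lgt0.
rewrite inver gt_eqF// -!EFinM lee_fin mulrACA ler_pdivlMr//.
by rewrite -(mulrA (a * b)%R) mulfVK ?gt_eqF// ler_pdivrMr.
Qed.
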